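(* Let $\mathcal{B}$ be a totally ordered alphabet and $\mathrm{x}\in\{\mathrm{l},\mathrm{r}\}$. The map $w\mapsto(\mathrm{P}_{\mathrm{xps}}(w),\mathrm{Q}_{\mathrm{xps}}(w))$ is a bijection from the set of words over $\mathcal{B}$ onto the $\mathrm{x}$PS stable pairs set over $\mathcal{B}$.
   Context: An alphabet is a totally ordered set; words are finite sequences of its elements. A composition diagram is a finite left-to-right sequence of nonempty bottom-justified columns of boxes; its shape is the sequence of column lengths; the bottom row consists of the lowest box of each column. An lps tableau over $\mathcal{B}$: filling of a composition diagram by elements of $\mathcal{B}$ with each column strictly increasing from bottom to top and bottom row weakly increasing left to right. An rps tableau: each column weakly increasing from bottom to top and bottom row strictly increasing left to right. ''xPS'' means lps if $\mathrm{x}=\mathrm{l}$, rps if $\mathrm{x}=\mathrm{r}$. A standard PS tableau is a tableau with pairwise distinct entries, each column strictly increasing bottom to top and bottom row strictly increasing left to right. A recording tableau is a standard PS tableau with $N$ boxes whose entries are exactly $1,\dots,N$. Extended PS insertion: for $w=w_1\cdots w_n$, build $P$ and $Q$ simultaneously starting from empty tableaux. At step $j$, with $r_1,\dots,r_k$ the bottom row of the current $P$: lps case: if $P$ is empty or $r_k\le w_j$, add a new rightmost column with one box containing $w_j$ to $P$ and a new rightmost column with one box containing $j$ to $Q$; otherwise let $m$ be least with $w_j<r_m$, move all entries of column $m$ of $P$ up one box and put $w_j$ in its bottom box, and add a new box containing $j$ on top of column $m$ of $Q$. rps case: same with conditions $r_k<w_j$ and $w_j\le r_m$. The results are $\mathrm{P}_{\mathrm{xps}}(w)$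 and $\mathrm{Q}_{\mathrm{xps}}(w)$. Standardization: $\mathcal{C}(\mathcal{B})=\{a_i: a\in\mathcal{B}, i\ge1\}$ ordered by $a_i<c_j$ iff $a<c$, or $a=c$ and $i<j$. For a tableau $R$ over $\mathcal{B}$, $\mathrm{Std}_{\mathrm{l}}(R)$ is obtained by reading the entries column by column left to right, each column top to bottom, and replacing the $i$-th occurrence of $a$ in this reading by $a_i$; $\mathrm{Std}_{\mathrm{r}}(R)$ likewise but reading columns right to left, each column bottom to top. Stable pairs: the column reading $\mathfrak{C}(T)$ of a tableau $T$ is the word obtained by reading the columns from left to right, each from top to bottom. For a tableau $S$, $S'$ is obtained by reversing the order of entries in each column. For words $u,t$ of the same length with distinct letters and permutation patterns $p,q$ of length 3, $(u,t)$ has a simultaneous occurrence of $(p,q)$ if there are indices $i$ and $k>i+1$ such that $u_iu_{i+1}u_k$ is order-isomorphic to $p$ and $t_it_{i+1}t_k$ is order-isomorphic to $q$. A pair $(R,S)$ of standard PS tableaux of the same shape is stable if $(\mathfrak{C}(R),\mathfrak{C}(S'))$ has no simultaneous occurrence of any of $(312,132)$, $(312,231)$, $(321,132)$. The $\mathrm{x}$PS stable pairs set over $\mathcal{B}$ is the set of pairs $(R,S)$ where $R$ is an $\mathrm{x}$PS tableau over $\mathcal{B}$, $S$ is a recording tableau, and $(\mathrm{Std}_{\mathrm{x}}(R),S)$ is a stable pair. *)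

(* Defs.v *)
From mathcomp Require Import all_boot all_order.

Set Implicit Arguments.
Unset Strict Implicit.
Unset Printing Implicit Defensive.

Import Order.TTheory.
Local Open Scope order_scope.

Variant side := Left | Right.

(* A filling is the left-to-right list of its columns, each column being listed
   from bottom to top; the underlying composition is [shape T]. *)
Definition tableau (T : Type) := seq (seq T).

Definition nonempty_columns (T : Type) (P : tableau T) : bool :=
  all (fun c => 0 < size c)%N P.

Definition bottom_row (T : Type) (P : tableau T) : seq T := pmap ohead P.

Definition xps_tableau (d : Order.disp_t) (B : orderType d) (x : side)
    (P : tableau B) : bool :=
  nonempty_columns P &&
  match x with
  | Left => all (sorted <%O) P && sorted <=%O (bottom_row P)
  | Right => all (sorted <=%O) P && sorted <%O (bottom_row P)
  end.

Definition standard_ps (d : Order.disp_t) (T : orderType d) (P : tableau T)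
    : bool :=
  [&& nonempty_columns P, uniq (flatten P), all (sorted <%O) P
    & sorted <%O (bottom_row P)].

Definition recording (Q : tableau nat) : bool :=
  standard_ps Q && perm_eq (flatten Q) (iota 1 (size (flatten Q))).

Section Insertion.
Variables (d : Order.disp_t) (B : orderType d) (x : side).

Definition opens_column (r : seq B) (a : B) : bool :=
  if r is r1 :: r' then
    match x with
    | Left => last r1 r' <= a
    | Right => last r1 r' < a
    end
  else true.

Definition bumps (a b : B) : bool :=
  match x with Left => a < b | Right => a <= b end.

Definition ps_step (PQ : tableau B * tableau nat) (ja : nat * B)
    : tableau B * tableau nat :=
  let: (P, Q) := PQ in
  let: (j, a) := ja in
  let r := bottom_row P in
  if opens_column r a then (rcons P [:: a], rcons Q [:: j])
  else
    let m := find (bumps a) r in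
    (set_nth [::] P m (a :: nth [::] P m),
     set_nth [::] Q m (rcons (nth [::] Q m) j)).

Definition ps_insertion (w : seq B) : tableau B * tableau nat :=
  foldl ps_step ([::], [::]) (zip (iota 1 (size w)) w).

Definition P_ps (w : seq B) : tableau B := (ps_insertion w).1.
Definition Q_ps (w : seq B) : tableau nat := (ps_insertion w).2.

End Insertion.

(* Columns from left to right, each from top to bottom. *)
Definition column_reading (T : Type) (P : tableau T) : seq T :=
  flatten (map rev P).

Definition reverse_columns (T : Type) (P : tableau T) : tableau T := map rev P.

Section Standardization.
Variables (d : Order.disp_t) (B : orderType d).

(* The letter a_i is the pair (a, i), under the lexicographic order of
   [B *l nat]; only indices i >= 1 are produced. *)
Fixpoint std_word_from (seen w : seq B) : seq (B *l nat) :=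
  if w is a :: w' then
    ((a, (count_mem a seen).+1) : B *l nat) :: std_word_from (a :: seen) w'
  else [::].

Definition std_word (w : seq B) : seq (B *l nat) := std_word_from [::] w.

(* The reading word is standardized and then poured back into the boxes it was
   read from; for [Right] it runs through the columns from right to left, each
   from bottom to top. *)
Definition Std (x : side) (P : tableau B) : tableau (B *l nat) :=
  match x with
  | Left => map rev (reshape (shape P) (std_word (column_reading P)))
  | Right => rev (reshape (rev (shape P)) (std_word (flatten (rev P))))
  end.

End Standardization.

Definition order_isomorphic (d1 d2 : Order.disp_t) (T1 : orderType d1)
    (T2 : orderType d2) (u : seq T1) (v : seq T2) : bool :=
  (size u == size v) &&
  all2rel (fun a b => (a.1 < b.1) == (a.2 < b.2)) (zip u v).

Definition letters_at (T : Type) (u : seq T) (I : seq nat) : seq T :=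
  pmap (onth u) I.

Definition simultaneous_occurrence (d1 d2 : Order.disp_t) (T1 : orderType d1)
    (T2 : orderType d2) (u : seq T1) (t : seq T2) (p q : seq nat) : Prop :=
  exists i k : nat,
    [/\ (i.+1 < k < size u)%N,
        order_isomorphic (letters_at u [:: i; i.+1; k]) p
      & order_isomorphic (letters_at t [:: i; i.+1; k]) q].

Definition stable_pair (d1 d2 : Order.disp_t) (T1 : orderType d1)
    (T2 : orderType d2) (R : tableau T1) (S : tableau T2) : Prop :=
  let u := column_reading R in
  let t := column_reading (reverse_columns S) in
  [/\ standard_ps R, standard_ps S & shape R = shape S] /\
  [/\ ~ simultaneous_occurrence u t [:: 3; 1; 2]%N [:: 1; 3; 2]%N,
      ~ simultaneous_occurrence u t [:: 3; 1; 2]%N [:: 2; 3; 1]%N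
    & ~ simultaneous_occurrence u t [:: 3; 2; 1]%N [:: 1; 3; 2]%N].

Definition xps_stable_pairs (d : Order.disp_t) (B : orderType d) (x : side)
    (R : tableau B) (S : tableau nat) : Prop :=
  [/\ xps_tableau x R, recording S & stable_pair (Std x R) S].

(* Main.v *)
Require Import Defs.
From mathcomp Require Import all_boot all_order.
Set Implicit Arguments.
Unset Strict Implicit.
Unset Printing Implicit Defensive.
Import Order.TTheory.


(** Reading the columns of [P] from top to bottom and those of [Q] from bottom
    to top lists, column by column, the letters in the order in which they were
    inserted together with their insertion times, so [(P, Q)] is the same thing
    as a tableau [C] of cells (time, letter).  A letter [z] inserted at time [r]
    passes over a column exactly when it does not bump the entry that is at the
    bottom of this column at time [r] ([clears] below).  The tableaux of cells in
    which every cell clears all the columns on its left are closed under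
    insertion, and removing the latest cell undoes the last insertion; this
    gives the bijection with words.  Standardization turns comparison of letters
    in column reading order into [bumps], and avoiding (312,132) and (321,132)
    together says that no [z] bumps [a] when it sits to the right of adjacent
    entries [a], [b] of a column and was inserted between them in time; the
    pattern (312,231) is then avoided automatically. *)

(** * Tableaux of cells, and insertion as the addition of a latest cell *)

Section Cells.
Variables (d : Order.disp_t) (B : orderType d) (x : side).
Implicit Types (a b c : B) (z e f : nat * B) (s t : seq (nat * B)).
Implicit Types (C D : seq (seq (nat * B))) (w : seq B).

Lemma bumps_trans b a c : bumps x a b -> bumps x b c -> bumps x a c.
Proof. by case: x => /=; [apply: lt_trans | apply: le_trans]. Qed.

(** One of [bumps] and its negated converse is the strict order and the other the weak one; mixed
    transitivity lets later arguments treat both sides at once. *)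
Lemma bumpsN_trans b a c : bumps x a b -> ~~ bumps x c b -> bumps x a c.
Proof.
case: x => /=; rewrite -?leNgt -?ltNge; first exact: lt_le_trans.
by move=> ab /(le_lt_trans ab)/ltW.
Qed.

Lemma Nbumps_trans b a c : ~~ bumps x b a -> ~~ bumps x c b -> ~~ bumps x c a.
Proof.
by move=> nba; apply: contra => ca; apply: bumpsN_trans ca nba.
Qed.

(** The reversal is there because a column grows at its bottom in [P] but at its top in [Q]. *)
Definition letters C : tableau B := [seq rev (map snd s) | s <- C].
Definition times C : tableau nat := [seq map fst s | s <- C].

(* Columns of cells are listed in order of insertion, so the condition on the
   tail says that [e] is at the bottom of the column at the time of [z]. *)
Fixpoint clears z s : bool :=
  if s is e :: s' then
    (all (fun f => z.1 < f.1)%N s' ==> ~~ bumps x z.2 e.2) && clears z s'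
  else true.

(* The [has] clause records that [s] was opened before [t]. *)
Definition precedes s t : bool :=
  all (fun z => has (fun e => e.1 < z.1)%N s && clears z s) t.

(** One relation serves both tableaux: a column sorted by [falls] has increasing times in [Q] and a
    legal column of letters in [P]. *)
Definition falls e f : bool := (e.1 < f.1)%N && bumps x f.2 e.2.

Definition valid C : bool :=
  [&& all (fun s => s != [::]) C, all (sorted falls) C & pairwise precedes C].

Lemma falls_trans : transitive falls.
Proof.
move=> e f g /andP[fe b1] /andP[eg b2]; rewrite /falls (ltn_trans fe eg) /=.
exact: bumps_trans b2 b1.
Qed.

(** A cell later than [z] does not alter the tests against the cells before it, and the last cell of
    a column is always tested. *)
Lemma clears_rcons z s e : (z.1 < e.1)%N ->
  clears z (rcons s e) = clears z s && ~~ bumps x z.2 e.2.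
Proof.
by move=> ze; elim: s => [|f s IH] /=; rewrite ?andbT // all_rcons ze IH andbA.
Qed.

Lemma clears_last z s e : s != [::] -> clears z s -> ~~ bumps x z.2 (last e s).2.
Proof.
elim: s e => // f [|g s] IH e _; first by rewrite /= andbT.
by case/andP=> _; apply: IH.
Qed.

(** Every cell but the last is followed by one no later than [z], so its test is void. *)
Lemma clears_late z s e : s != [::] -> all (fun f => f.1 <= z.1)%N s ->
  clears z s = ~~ bumps x z.2 (last e s).2.
Proof.
elim: s e => // f [|g s] IH e _; first by rewrite /= !andbT.
move=> /andP[_ le_gs]; rewrite [LHS]/= -/(clears z (g :: s)) (IH f) //.
by case/andP: le_gs => /= gz _; rewrite ltnNge gz.
Qed.

Lemma precedes_last s t e : s != [::] -> t != [::] -> precedes s t ->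
  ~~ bumps x (last e t).2 (last e s).2.
Proof.
move=> s0 t0 /allP/(_ (last e t)); case: t t0 => //= f t _.
by rewrite mem_last => /(_ isT)/andP[_ /clears_last-> ].
Qed.

Lemma bottom_row_letters e C : all (fun s => s != [::]) C ->
  bottom_row (letters C) = [seq (last e s).2 | s <- C].
Proof.
elim: C => //= s C IH /andP[s0 /IH{}IH]; case/lastP: s s0 => // s f _.
by rewrite map_rcons rev_rcons last_rcons /bottom_row /= -IH.
Qed.

Lemma ps_step_open C e : all (fun s => s != [::]) C ->
  all (fun s => ~~ bumps x e.2 (last e s).2) C ->
  ps_step x (letters C, times C) e
  = (letters (rcons C [:: e]), times (rcons C [:: e])).
Proof.
case: e => j a C0 /= Ca.
rewrite /ps_step (bottom_row_letters (j, a) C0).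
suff -> : opens_column x [seq (last (j, a) s).2 | s <- C] a.
  by rewrite /letters /times !map_rcons.
case: C C0 Ca => //= s C _ aC.
have: all (fun b => ~~ bumps x a b)
    ((last (j, a) s).2 :: [seq (last (j, a) s).2 | s <- C]).
  by rewrite /= all_map.
move=> /allP/(_ _ (mem_last _ _)).
by case: x => /=; rewrite -?leNgt -?ltNge.
Qed.

Lemma set_nth_cat_cons (T : Type) (y0 : T) (l r : seq T) (y y' : T) n :
  n = size l -> set_nth y0 (l ++ y :: r) n y' = l ++ y' :: r.
Proof. by move=> ->; elim: l => //= u l ->. Qed.

(** Bottom letters right of [s] are not bumpers of the bottom of [s], so [e] bumps them all, in
    particular the rightmost one, and no column is opened; [find] stops at [s] because nothing in
    [C] is bumped. *)
Lemma ps_step_bump C D s e : all (fun s => s != [::]) (C ++ s :: D) ->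
  all (fun s => ~~ bumps x e.2 (last e s).2) C ->
  bumps x e.2 (last e s).2 -> pairwise precedes (s :: D) ->
  ps_step x (letters (C ++ s :: D), times (C ++ s :: D)) e
  = (letters (C ++ rcons s e :: D), times (C ++ rcons s e :: D)).
Proof.
case: e => j a CD0 /= Ca sa /andP[sD _].
rewrite /ps_step (bottom_row_letters (j, a) CD0) map_cat /=.
set r := map _ C; set r' := map _ D.
have ->: opens_column x (r ++ (last (j, a) s).2 :: r') a = false.
  have: bumps x a (last (last (j, a) s).2 r').
    have: all (bumps x a) ((last (j, a) s).2 :: r').
      move: CD0; rewrite all_cat /= => /and3P[_ s0 D0].
      rewrite /= sa /r' all_map; apply/allP=> t tD /=.
      apply: (bumpsN_trans sa).
      exact: precedes_last s0 (allP D0 t tD) (allP sD t tD).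
    by move=> /allP/(_ _ (mem_last _ _)).
  case: r => [|b r] /=; rewrite ?last_cat /=;
  by case: x => /= H; apply/negbTE; rewrite -?leNgt -?ltNge.
have -> : find (bumps x a) (r ++ (last (j, a) s).2 :: r') = size C.
  rewrite find_cat /= sa addn0 size_map has_map; case: hasP => // -[t tC /= at_].
  by move: (allP Ca _ tC); rewrite at_.
rewrite /letters /times !map_cat /= !nth_cat !size_map ltnn subnn /=.
by rewrite !set_nth_cat_cons ?size_map // map_rcons rev_rcons map_rcons.
Qed.


Lemma precedes_rconsl s t e : all (fun z => z.1 < e.1)%N t ->
  precedes (rcons s e) t = precedes s t && all (fun z => ~~ bumps x z.2 e.2) t.
Proof.
move=> te; rewrite /precedes -all_predI; apply: eq_in_all => z /(allP te) ze /=.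
by rewrite has_rcons clears_rcons // ltnNge (ltnW ze) andbA.
Qed.

Lemma precedes_rconsr s t e : s != [::] -> all (fun f => f.1 < e.1)%N s ->
  precedes s (rcons t e) = precedes s t && ~~ bumps x e.2 (last e s).2.
Proof.
move=> s0 se; rewrite /precedes all_rcons andbC; congr (_ && _).
have es : all (fun f => f.1 <= e.1)%N s by apply: sub_all se => f /ltnW.
rewrite (clears_late e s0 es).
by case: s s0 se {es} => //= f s _ /andP[->].
Qed.

(** This and [valid_bump] are equivalences, used in one direction to add the latest cell and in the
    other to remove it. *)
Lemma valid_open C e : all (fun f => f.1 < e.1)%N (flatten C) ->
  valid (rcons C [:: e]) =
    valid C && all (fun s => ~~ bumps x e.2 (last e s).2) C.
Proof.
move=> Ce; rewrite /valid !all_rcons /= -[in pairwise _ _]cats1 pairwise_cat /=.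
case C0 : (all _ C) => //=; rewrite !andbT -!andbA; congr (_ && _); rewrite andbC.
congr (_ && _); rewrite allrel1r; apply: eq_in_all => s sC.
rewrite (@precedes_rconsr s [::] e (allP C0 s sC)) //.
by apply/allP=> f fs; apply: (allP Ce); apply/flattenP; exists s.
Qed.

Lemma valid_bump C s D e : s != [::] ->
  all (fun f => f.1 < e.1)%N (flatten (C ++ s :: D)) ->
  valid (C ++ rcons s e :: D) =
    [&& valid (C ++ s :: D), all (fun s => ~~ bumps x e.2 (last e s).2) C
      & bumps x e.2 (last e s).2].
Proof.
move=> s0; rewrite flatten_cat all_cat /= all_cat => /and3P[Ce se De].
rewrite /valid !all_cat /= !pairwise_cat /= !allrel_consr s0.
have -> : rcons s e != [::] by case: (s).
case C0 : (all _ C) => //=; case: (all (fun s => s != [::]) D) => //=.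
have -> : sorted falls (rcons s e) = sorted falls s && bumps x e.2 (last e s).2.
  case: s s0 se => // f s _ /allP/(_ _ (mem_last f s)) /= se.
  by rewrite rcons_path /falls se.
have -> : all (precedes^~ (rcons s e)) C
        = all (precedes^~ s) C && all (fun s => ~~ bumps x e.2 (last e s).2) C.
  rewrite -all_predI; apply: eq_in_all => t tC /=.
  rewrite (precedes_rconsr _ (allP C0 t tC)) //.
  by apply/allP=> f ft; apply: (allP Ce); apply/flattenP; exists t.
have -> : all (precedes (rcons s e)) D
        = all (precedes s) D && all (all (fun z => ~~ bumps x z.2 e.2)) D.
  rewrite -all_predI; apply: eq_in_all => t tD /=; apply: precedes_rconsl.
  by apply/allP=> f ft; apply: (allP De); apply/flattenP; exists t.
(* The columns on the right impose nothing new: a cell of theirs that bumps [e] would also bump the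
   former bottom of [s], which it clears. *)
have: bumps x e.2 (last e s).2 -> all (precedes s) D ->
      all (all (fun z => ~~ bumps x z.2 e.2)) D.
  move=> es /allP sD; apply/allP=> t /sD/allP st; apply/allP=> z /st.
  case/andP=> _ /(clears_last e s0).
  by apply: contra => /bumps_trans; apply.
case: (bumps _ _ _) => [/(_ isT)|_]; last by rewrite !(andbF, andFb).
case: (all (precedes s) D) => [/(_ isT)->|_]; last by rewrite !(andbF, andFb).
rewrite !andbT; case: (all (fun s => ~~ _) C); by rewrite !(andbT, andbF).
Qed.

(** * Words and valid tableaux of cells *)

Definition cells w : seq (nat * B) := zip (iota 1 (size w)) w.

Lemma cells_rcons w a : cells (rcons w a) = rcons (cells w) ((size w).+1, a).
Proof.
rewrite /cells size_rcons -[in LHS](addn1 (size w)) iotaD cats1.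
by rewrite zip_rcons ?size_iota.
Qed.

Lemma cells_lt w f : f \in cells w -> (f.1 < (size w).+1)%N.
Proof.
move=> fw; have: f.1 \in unzip1 (cells w) by apply: map_f.
by rewrite unzip1_zip ?size_iota // mem_iota add1n => /andP[].
Qed.

Lemma ps_insertion_rcons w a :
  ps_insertion x (rcons w a) = ps_step x (ps_insertion x w) ((size w).+1, a).
Proof. by rewrite /ps_insertion -/(cells _) cells_rcons foldl_rcons. Qed.

Lemma perm_flatten_rcons C D s e :
  perm_eq (flatten (C ++ rcons s e :: D)) (rcons (flatten (C ++ s :: D)) e).
Proof.
by rewrite !flatten_cat /= -!cats1 -!catA !perm_cat2l perm_catC.
Qed.

Lemma ps_insertion_valid w : exists C,
  [/\ valid C, perm_eq (flatten C) (cells w)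
    & ps_insertion x w = (letters C, times C)].
Proof.
elim/last_ind: w => [|w a [C [vC Cw IH]]]; first by exists [::].
rewrite ps_insertion_rcons IH cells_rcons; set e := (_, a).
have Ce : all (fun f => f.1 < e.1)%N (flatten C).
  by apply/allP=> f; rewrite (perm_mem Cw) => /cells_lt.
have /and3P[C0 _ CC] := vC.
case hasC: (has (fun s => bumps x e.2 (last e s).2) C); last first.
  have NC : all (fun s => ~~ bumps x e.2 (last e s).2) C by rewrite all_predC hasC.
  exists (rcons C [:: e]); rewrite valid_open // vC ps_step_open //; split=> //.
  by rewrite flatten_rcons cats1 -!cats1 perm_cat2r.
(* [s] is the leftmost column whose bottom letter is bumped, the one that insertion selects. *)
case/split_find: hasC vC Cw Ce C0 CC {IH} => s C1 D es; rewrite -all_predC => NC1.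
rewrite cat_rcons => vC Cw Ce C0 CC.
exists (C1 ++ rcons s e :: D); split.
- rewrite valid_bump ?vC ?es ?andbT //.
  by move: C0; rewrite all_cat => /and3P[].
- by rewrite (perm_trans (perm_flatten_rcons _ _ _ _)) // -!cats1 perm_cat2r.
- apply: ps_step_bump => //.
  by move: CC; rewrite pairwise_cat => /and3P[].
Qed.

(** Induction on the word from its end: the latest cell is removed, the rest is valid and comes from
    the shorter word, and inserting the last letter puts the cell back. *)
Lemma ps_insertion_of_valid C w : valid C -> perm_eq (flatten C) (cells w) ->
  ps_insertion x w = (letters C, times C).
Proof.
elim/last_ind: w C => [|w a IH] C vC.
  move=> /perm_size; case: C vC => [|[|f s] C] //=.
rewrite cells_rcons ps_insertion_rcons; set e := (_, a) => Cw.
have eC : e \in flatten C by rewrite (perm_mem Cw) mem_rcons mem_head.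
have leC f : f \in flatten C -> (f.1 <= e.1)%N.
  rewrite (perm_mem Cw) mem_rcons inE => /predU1P[->//|/cells_lt].
  exact: ltnW.
case/flattenP: eC => s sC es; case/splitPr: sC vC Cw leC => C1 D.
(* The latest cell ends its column, since a cell after it would be later still. *)
case/splitPr: es => s1 [|f s2] vC Cw leC; last first.
  case/and3P: vC => _ /allP/(_ (s1 ++ e :: f :: s2)).
  rewrite mem_cat mem_head orbT => /(_ isT)/cat_sorted2[_ /= /andP[/andP[ef _] _]] _.
  have: f \in flatten (C1 ++ (s1 ++ e :: f :: s2) :: D).
    by rewrite flatten_cat /= !mem_cat !inE eqxx !orbT.
  by move/leC; rewrite leqNgt ef.
rewrite cats1 in vC Cw leC *.
have Cw1 : perm_eq (flatten (C1 ++ s1 :: D)) (cells w).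
  move: (perm_flatten_rcons C1 D s1 e); rewrite (permPl Cw) -!cats1 perm_cat2r.
  by rewrite perm_sym.
have Ce1 : all (fun f => f.1 < e.1)%N (flatten (C1 ++ s1 :: D)).
  by apply/allP=> f; rewrite (perm_mem Cw1) => /cells_lt.
case: (eqVneq s1 [::]) => [s10 | s10].
  (* A latest cell alone in its column is in the last column: by the [has] clause of [precedes],
     cells further right would be later than it. *)
  have D0 : D = [::].
    case: D vC Ce1 {Cw1 Cw leC} => // t D /and3P[]; rewrite s10 !all_cat.
    case/andP=> _ /= /andP[]; case: t => // f t _ _ _.
    rewrite pairwise_cat => /and3P[_ _ /= /andP[/andP[/andP[/andP[ef _] _] _] _]].
    rewrite flatten_cat all_cat /= => /and3P[_ fe _].
    by move: ef; rewrite /= orbF ltnNge (ltnW fe).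
  rewrite {}D0 {}s10 in vC Cw1 Ce1 *.
  rewrite flatten_cat /= cats0 in Cw1 Ce1; rewrite cats1.
  move: vC; rewrite cats1 valid_open // => /andP[vC NC].
  by rewrite (IH C1) // ps_step_open //; case/and3P: vC.
move: vC; rewrite valid_bump // => /and3P[vC NC es].
rewrite (IH _ vC Cw1) ps_step_bump //; first by case/and3P: vC.
by case/and3P: vC => _ _; rewrite pairwise_cat => /and3P[].
Qed.

Lemma cells_inj : injective cells.
Proof.
move=> w w' /(congr1 unzip2).
by rewrite /cells !unzip2_zip ?size_iota.
Qed.

Lemma sorted_cells w : sorted (fun e f => e.1 < f.1)%N (cells w).
Proof.
have: sorted ltn (unzip1 (cells w)).
  by rewrite unzip1_zip ?size_iota // iota_ltn_sorted.
by rewrite sorted_map.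
Qed.

(** Times increase strictly along [cells w], so the multiset of cells fixes their order. *)
Lemma cells_perm w w' : perm_eq (cells w) (cells w') -> w = w'.
Proof.
move=> ww'; apply: cells_inj.
apply: (@irr_sorted_eq _ (fun e f => e.1 < f.1)%N) (sorted_cells _) (sorted_cells _) _.
- by move=> e f g; apply: ltn_trans.
- by move=> e; apply: ltnn.
- exact: perm_mem.
Qed.

Lemma letters_times_inj C D : letters C = letters D -> times C = times D -> C = D.
Proof.
elim: C D => [|s C IH] [|t D] //= [/(can_inj revK) st CD] [st' CD']; congr (_ :: _).
  by rewrite -[s]zip_unzip -[t]zip_unzip /unzip1 /unzip2 st st'.
exact: IH.
Qed.

Lemma ps_insertion_inj : injective (ps_insertion (B := B) x).
Proof.
move=> w w'; have [C [_ Cw ->]] := ps_insertion_valid w.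
have [D [_ Dw ->]] := ps_insertion_valid w' => -[CD CD'].
move: Dw; rewrite -(letters_times_inj CD CD') (permPl Cw) => /cells_perm.
by [].
Qed.

End Cells.

(** * Column readings, shapes and bottom rows *)

Lemma pairwise_rev (T : Type) (r : rel T) (s : seq T) :
  pairwise r (rev s) = pairwise (fun y z => r z y) s.
Proof.
by elim: s => //= y s IH; rewrite rev_cons pairwise_rcons all_rev IH.
Qed.

Lemma column_reading_map (T T' : Type) (f : T -> T') (P : tableau T) :
  column_reading (map (map f) P) = map f (column_reading P).
Proof.
rewrite /column_reading map_flatten -!map_comp.
by congr flatten; apply: eq_map => s /=; rewrite map_rev.
Qed.

Lemma bottom_row_map (T T' : Type) (f : T -> T') (P : tableau T) :
  bottom_row (map (map f) P) = map f (bottom_row P).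
Proof. by elim: P => //= -[|y s] P /= IH; rewrite /bottom_row /= -IH. Qed.

Lemma shape_map (T T' : Type) (f : T -> T') (P : tableau T) :
  shape (map (map f) P) = shape P.
Proof. by rewrite /shape -map_comp; apply: eq_map => s /=; rewrite size_map. Qed.

Lemma shape_map_rev (T : Type) (P : tableau T) : shape (map rev P) = shape P.
Proof. by rewrite /shape -map_comp; apply: eq_map => s /=; rewrite size_rev. Qed.

Lemma size_column_reading (T : Type) (P : tableau T) :
  size (column_reading P) = sumn (shape P).
Proof. by rewrite size_flatten shape_map_rev. Qed.

(** The right-hand side is the word numbered by [Std Right], so one reading order will do for both
    sides. *)
Lemma rev_column_reading (T : Type) (P : tableau T) :
  rev (column_reading P) = flatten (rev P).
Proof. by rewrite rev_flatten (mapK revK). Qed.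

Lemma column_reading_inj (T : Type) (P P' : tableau T) :
  column_reading P = column_reading P' -> shape P = shape P' -> P = P'.
Proof.
move=> PP' sPP'; apply: (inj_map (can_inj revK)).
by apply: eq_from_flatten_shape; rewrite // !shape_map_rev.
Qed.

Lemma perm_column_reading (T : eqType) (P : tableau T) :
  perm_eq (column_reading P) (flatten P).
Proof.
by elim: P => //= s P IH; rewrite /column_reading /= perm_cat ?perm_rev.
Qed.

Lemma bottom_row_subseq (T : eqType) (P : tableau T) :
  subseq (bottom_row P) (column_reading P).
Proof.
elim: P => //= -[|y s] P IH; rewrite /bottom_row /column_reading //=.
rewrite rev_cons -cats1 -catA; apply: (subseq_trans _ (suffix_subseq _ _)).
by rewrite /= eqxx.
Qed.

(** * Standardization and the order of letters *)

Section Std.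
Variables (d : Order.disp_t) (B : orderType d) (x : side).
Implicit Types (a b : B) (w : seq B) (P : tableau B).

Lemma xps_tableauE P : xps_tableau x P =
  [&& nonempty_columns P, all (sorted (bumps x)) P
    & sorted (fun a b => ~~ bumps x b a) (bottom_row P)].
Proof.
rewrite /xps_tableau; congr (_ && _); case: x => /=; congr (_ && _).
  by case: bottom_row => //= a s; apply: eq_path => b c; rewrite -leNgt.
by case: bottom_row => //= a s; apply: eq_path => b c; rewrite -ltNge.
Qed.

Lemma map_fst_std_word_from seen w : map fst (std_word_from seen w) = w.
Proof. by elim: w seen => //= a w IH seen; rewrite IH. Qed.

Lemma std_word_from_count seen w :
  all (fun u => count_mem u.1 seen < u.2)%N (std_word_from seen w).
Proof.
elim: w seen => //= a w IH seen; rewrite ltnSn /=.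
by apply: sub_all (IH (a :: seen)) => u /=; apply: leq_ltn_trans; apply: leq_addl.
Qed.

Lemma std_word_from_pairwise seen w :
  pairwise (fun u v : B *l nat => (u.1 == v.1) ==> (u.2 < v.2)%N)
    (std_word_from seen w).
Proof.
elim: w seen => //= a w IH seen; rewrite IH andbT.
apply: sub_all (std_word_from_count (a :: seen) w) => u /=.
by case: eqP => //= ->; rewrite add1n.
Qed.

(** Standardized letters in column reading order for either side; for [Right] only the numbering
    runs backwards. *)
Definition std_reading w : seq (B *l nat) :=
  match x with
  | Left => std_word w
  | Right => rev (std_word (rev w))
  end.

Lemma map_fst_std_reading w : map fst (std_reading w) = w.
Proof.
rewrite /std_reading /std_word; case: x; first exact: map_fst_std_word_from.
by rewrite map_rev map_fst_std_word_from revK.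
Qed.

Lemma size_std_reading w : size (std_reading w) = size w.
Proof. by rewrite -(size_map fst) map_fst_std_reading. Qed.

Definition std_compatible (u v : B *l nat) : bool :=
  ((v < u)%O == bumps x v.1 u.1) && (u != v).

(** Only equal letters matter: the later one has the larger index for [Left], where [bumps] is
    strict, and the smaller one for [Right], where [bumps] is weak. *)
Lemma std_reading_pairwise w : pairwise std_compatible (std_reading w).
Proof.
rewrite /std_reading /std_word /std_compatible; case: x.
  apply: sub_pairwise (std_word_from_pairwise [::] w) => -[a i] [b j] /=.
  rewrite ltEprodlexi /= ltEnat /= xpair_eqE.
  case: (ltgtP a b) => //= _ ij.
  by rewrite ltnNge (ltnW ij) neq_ltn ij.
rewrite pairwise_rev.
apply: sub_pairwise (std_word_from_pairwise [::] (rev w)) => -[a i] [b j] /=.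
rewrite ltEprodlexi /= ltEnat /= xpair_eqE.
case: (ltgtP a b) => //= _ ij.
by rewrite ij neq_ltn ij orbT.
Qed.

Lemma size_std_word w : size (std_word w) = size w.
Proof. by rewrite -(size_map fst) map_fst_std_word_from. Qed.

Lemma StdE P :
  Std x P = map rev (reshape (shape P) (std_reading (column_reading P))).
Proof.
rewrite /Std /std_reading; case: x => //.
rewrite rev_reshape ?revK -?rev_column_reading //.
by rewrite size_std_word size_rev size_column_reading sumn_rev.
Qed.

Lemma column_reading_Std P :
  column_reading (Std x P) = std_reading (column_reading P).
Proof.
rewrite /column_reading StdE (mapK revK) reshapeKr //.
by rewrite size_std_reading size_column_reading.
Qed.

Lemma shape_Std P : shape (Std x P) = shape P.
Proof.
by rewrite StdE shape_map_rev reshapeKl // size_std_reading size_column_reading.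
Qed.

Lemma map_fst_Std P : map (map fst) (Std x P) = P.
Proof.
apply: column_reading_inj; last by rewrite shape_map shape_Std.
by rewrite column_reading_map column_reading_Std map_fst_std_reading.
Qed.

Lemma standard_ps_Std P : xps_tableau x P -> standard_ps (Std x P).
Proof.
have pwP : pairwise std_compatible (column_reading (Std x P)).
  by rewrite column_reading_Std std_reading_pairwise.
(* [P] becomes the first components of its standardization [J], so that both sets of conditions
   concern the same boxes. *)
rewrite xps_tableauE -{1 2 3}(map_fst_Std P); move: (Std x P) pwP => J pwJ.
rewrite bottom_row_map sorted_map => /and3P[J0 Js Jb]; apply/and4P; split.
- move: J0; rewrite /nonempty_columns all_map.
  by apply: sub_all => s /=; rewrite size_map.
- rewrite -(perm_uniq (perm_column_reading J)) uniq_pairwise.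
  by apply: sub_pairwise pwJ => u v /andP[].
- apply/allP=> s sJ; move: Js; rewrite all_map => /allP/(_ s sJ) /=.
  rewrite sorted_map => ss.
  (* Columns are read from top to bottom, hence the reversal. *)
  have: pairwise std_compatible (rev s).
    apply: subseq_pairwise pwJ; case/splitPr: sJ => J1 J2.
    rewrite /column_reading map_cat flatten_cat /=.
    exact: subseq_trans (prefix_subseq _ _) (suffix_subseq _ _).
  move/pairwise_sorted; rewrite rev_sorted => ss'.
  move/andP: (conj ss ss'); rewrite -sorted_relI.
  by apply: sub_sorted => u v /= /andP[uv /andP[/eqP->]].
- have := subseq_pairwise (bottom_row_subseq J) pwJ => /pairwise_sorted Jb'.
  move/andP: (conj Jb Jb'); rewrite -sorted_relI.
  apply: sub_sorted => u v /= /andP[uv /andP[/eqP vu neq]].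
  by rewrite lt_neqAle neq leNgt vu.
Qed.

End Std.

(** * Patterns of length three as inequalities *)

Section Patterns.
Variables (d : Order.disp_t) (T : orderType d).
Implicit Types (a b c : T).

Lemma order_isomorphic312 a b c :
  order_isomorphic [:: a; b; c] [:: 3; 1; 2]%N = [&& b < a, c < a & b < c]%O.
Proof.
rewrite /order_isomorphic /allrel /= !ltEnat /= !ltxx.
by case: (ltgtP a b); case: (ltgtP a c); case: (ltgtP b c).
Qed.

Lemma order_isomorphic321 a b c :
  order_isomorphic [:: a; b; c] [:: 3; 2; 1]%N = [&& b < a, c < a & c < b]%O.
Proof.
rewrite /order_isomorphic /allrel /= !ltEnat /= !ltxx.
by case: (ltgtP a b); case: (ltgtP a c); case: (ltgtP b c).
Qed.

Lemma order_isomorphic132 a b c :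
  order_isomorphic [:: a; b; c] [:: 1; 3; 2]%N = [&& a < b, a < c & c < b]%O.
Proof.
rewrite /order_isomorphic /allrel /= !ltEnat /= !ltxx.
by case: (ltgtP a b); case: (ltgtP a c); case: (ltgtP b c).
Qed.

Lemma order_isomorphic231 a b c :
  order_isomorphic [:: a; b; c] [:: 2; 3; 1]%N = [&& a < b, c < a & c < b]%O.
Proof.
rewrite /order_isomorphic /allrel /= !ltEnat /= !ltxx.
by case: (ltgtP a b); case: (ltgtP a c); case: (ltgtP b c).
Qed.

Lemma letters_at3 a u i j k :
  (i < size u)%N -> (j < size u)%N -> (k < size u)%N ->
  letters_at u [:: i; j; k] = [:: nth a u i; nth a u j; nth a u k].
Proof.
have onthS n : (n < size u)%N -> onth u n = Some (nth a u n).
  by move=> nu; rewrite onthE (nth_map a).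
by move=> iu ju ku; rewrite /letters_at /= !onthS.
Qed.

End Patterns.

(** * Conditions on two adjacent entries and a later one *)

Section Adjacent.
Variables (T : eqType) (r : T -> T -> T -> bool).
Implicit Types (s l : seq T).

(** The index condition of [simultaneous_occurrence], put in a recursive form that follows the
    columns. *)
Fixpoint adjacent s : bool :=
  if s is y :: s' then
    (if s' is z :: s'' then all (r y z) s'' else true) && adjacent s'
  else true.

Lemma adjacent_catr l s : adjacent (l ++ s) -> adjacent s.
Proof. by elim: l => //= y l IH /andP[_]. Qed.

Lemma adjacentP y0 s : reflect
  (forall i k, (i.+1 < k < size s)%N ->
     r (nth y0 s i) (nth y0 s i.+1) (nth y0 s k))
  (adjacent s).
Proof.
elim: s => [|y s IH] /=; first by apply: ReflectT => i k; rewrite ltn0 andbF.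
apply: (iffP andP) => [[ys /IH{}IH] i k|ys].
  case: i k => [|i] [|k] //=; last exact: IH.
  case: s ys {IH} => [|z s] ys; first by rewrite [(k.+1 < _)%N]ltnS ltn0 andbF.
  by case: k => // k; rewrite !ltnS /= => ks; apply: (all_nthP y0 ys).
split; last by apply/IH => i k ik; apply: (ys i.+1 k.+1).
case: s {IH} ys => // z s ys; apply/(all_nthP y0) => k ks.
exact: (ys 0 k.+2).
Qed.
End Adjacent.

(** * Validity as a local condition on the reading *)

Section StableCells.
Variables (d : Order.disp_t) (B : orderType d) (x : side).
Implicit Types (a b c : B) (z e f : nat * B) (s t : seq (nat * B)).
Implicit Types (C D : seq (seq (nat * B))) (w : seq B).

(** This forbids what the three pattern pairs share: the first letter is the largest, and the third
    time is below the second. *)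
Definition settled e f z : bool :=
  bumps x f.2 e.2 && bumps x z.2 e.2 ==> (f.1 <= z.1)%N.

(** With [e] older than [z], only the time pattern 132 is forbidden, under 312 or 321 for the
    letters. *)
Definition weakly_settled e f z : bool :=
  [&& bumps x f.2 e.2, bumps x z.2 e.2 & (e.1 < z.1)%N] ==> (f.1 <= z.1)%N.

Lemma falls_all e s : path (falls x) e s -> all (fun f => e.1 < f.1)%N s.
Proof.
by move/(order_path_min (@falls_trans _ _ x)); apply: sub_all => f /andP[].
Qed.

Lemma falls_last e s z : sorted (falls x) s -> z \in s ->
  (z == last e s) || bumps x (last e s).2 z.2.
Proof.
rewrite (sorted_pairwise (@falls_trans _ _ x)); case/lastP: s => // s f.
rewrite pairwise_rcons last_rcons mem_rcons inE => /andP[/allP sf _].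
by case/predU1P=> [->|/sf/andP[_ ->]]; rewrite ?eqxx ?orbT.
Qed.

(** If [e] ends its column, the next cell [f] clears it and cannot bump [e]. Otherwise [f] is in the
    same column; a later [z] of that column is younger than [f], and a [z] further right that is
    older than [f] met [e] at the bottom or before it arrived, so clearing forbids a bump. *)
Lemma valid_adjacent C : valid x C -> adjacent settled (flatten C).
Proof.
rewrite /valid; elim: C => //= s C IH /and3P[/andP[_ C0] /andP[ss sC] /andP[pC CC]].
have /IH : [&& all (fun s => s != [::]) C, all (sorted (falls x)) C
             & pairwise (precedes x) C] by apply/and3P.
have: all (clears x ^~ s) (flatten C).
  apply/allP=> z /flattenP[t tC zt].
  by have /allP/(_ z zt)/andP[] := allP pC t tC.
move: (flatten C) => {IH C0 sC pC CC} F.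
elim: s ss => //= e s IH ss sF sett; apply/andP; split; last first.
  apply: IH => //; first exact: path_sorted ss.
  by apply: sub_all sF => z /andP[].
case: s ss sF {IH} => [_|f s].
  case: F {sett} => //= f F /andP[/andP[fe _] _].
  by apply/allP=> z _; rewrite /settled (negbTE fe).
move=> /= /andP[_ fs] sF; rewrite all_cat; apply/andP; split.
  by apply: sub_all (falls_all fs) => z fz; rewrite /settled (ltnW fz) implybT.
apply: sub_all sF => z /andP[+ _]; rewrite /settled.
case: (ltnP z.1 f.1) => /=; last by rewrite implybT.
move=> zf; have -> : all (fun f => z.1 < f.1)%N s.
  by apply: sub_all (falls_all fs) => g; apply: ltn_trans.
by rewrite /= implybF => /negbTE->; rewrite andbF.
Qed.

(* If [z] is older than [e] then it had to clear the predecessor of [e], which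
   [e] bumps; the last hypothesis carries this information down the column. *)
Lemma weakly_settled_clears z e s F : path (falls x) e s ->
  adjacent weakly_settled (e :: s ++ F) -> z \in F ->
  ~~ bumps x z.2 (last e s).2 -> z.1 \notin map fst s ->
  (e.1 < z.1)%N || ~~ bumps x z.2 e.2 -> clears x z (e :: s).
Proof.
elim: s e => [|f s IH] e; first by move=> *; rewrite /= andbT.
move=> /= /andP[/andP[ef fe] fs] /andP[efF Fs] zF zl.
rewrite inE negb_or => /andP[zf zs] ez.
have zef : (z.1 < f.1)%N -> ~~ bumps x z.2 e.2.
  move=> ltzf; case/orP: ez => // ez; apply/negP=> ze.
  have: weakly_settled e f z by apply: (allP efF); rewrite mem_cat zF orbT.
  by rewrite /weakly_settled fe ze ez /= leqNgt ltzf.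
apply/andP; split.
  by apply/implyP=> /andP[/zef].
apply: (IH f) => //; case: (ltngtP f.1 z.1) zf => //= /zef + _.
by apply: contra => /bumps_trans; apply.
Qed.

(** The head of a column is its bottom in [Q], the last cell its bottom in [P]; [e] is a default
    value. *)
Definition bottoms_ordered e s t : bool :=
  ((head e s).1 < (head e t).1)%N && ~~ bumps x (last e t).2 (last e s).2.

Lemma valid_of_weakly_settled e C :
  all (fun s => s != [::]) C -> all (sorted (falls x)) C ->
  uniq (map fst (flatten C)) -> adjacent weakly_settled (flatten C) ->
  pairwise (bottoms_ordered e) C -> valid x C.
Proof.
move=> C0 sC; rewrite /valid C0 sC /=.
elim: C C0 sC => //= s C IH /andP[s0 C0] /andP[ss sC].
rewrite map_cat cat_uniq => /and3P[_ disj uC] adjC /andP[bC CC].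
rewrite IH ?(adjacent_catr adjC) // andbT.
apply/allP=> t tC; apply/allP=> z zt.
have t0 := allP C0 t tC; have /andP[st ts] := allP bC t tC.
have /= st_sorted := allP sC t tC.
have zC : z \in flatten C by apply/flattenP; exists t.
have zh : ((head e t).1 <= z.1)%N.
  case: t t0 st_sorted zt {tC st ts} => //= f t _ ft; rewrite inE.
  by case/predU1P=> [->//|/(allP (falls_all ft))/ltnW].
(* As [z] is the last cell of [t] or is bumped by it, a bump of the bottom of [s] by [z] would pass
   to the bottom of [t]. *)
have zl := falls_last e st_sorted zt.
case: s s0 ss st ts adjC disj {bC} => //= f s _ fs st ts adjC disj.
have fz : (f.1 < z.1)%N by apply: leq_trans st zh.
rewrite fz; apply: (weakly_settled_clears fs adjC zC) => //.
- apply: contra ts => zs; case/predU1P: zl => [<-//|tz].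
  exact: bumps_trans tz zs.
- apply: contra disj => zs; apply/hasP; exists z.1; first exact: map_f.
  by rewrite inE zs orbT.
- by rewrite fz.
Qed.

End StableCells.

(** * Stable pairs and valid tableaux of cells *)

Section StablePairs.
Variables (d : Order.disp_t) (B : orderType d) (x : side).
Implicit Types (e f z : nat * B) (s t : seq (nat * B)) (w : seq B).
Implicit Types (C : seq (seq (nat * B))).

Lemma lettersE C : letters C = map (map snd) (map rev C).
Proof. by rewrite -map_comp; apply: eq_map => s /=; rewrite map_rev. Qed.

Lemma column_reading_letters C : column_reading (letters C) = map snd (flatten C).
Proof. by rewrite lettersE column_reading_map /column_reading (mapK revK). Qed.

Lemma flatten_times C : flatten (times C) = map fst (flatten C).
Proof. by rewrite map_flatten. Qed.

Lemma column_reading_times C :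
  column_reading (reverse_columns (times C)) = map fst (flatten C).
Proof. by rewrite /column_reading (mapK revK) flatten_times. Qed.

Lemma shape_letters C : shape (letters C) = shape C.
Proof. by rewrite lettersE shape_map shape_map_rev. Qed.

Lemma shape_times C : shape (times C) = shape C.
Proof. exact: shape_map. Qed.

Lemma bottom_row_times e C : all (fun s => s != [::]) C ->
  bottom_row (times C) = [seq (head e s).1 | s <- C].
Proof. by elim: C => //= -[|f s] C //= IH /IH <-. Qed.

Lemma nonempty_columns_times C :
  nonempty_columns (times C) = all (fun s => s != [::]) C.
Proof. by rewrite /nonempty_columns all_map; apply: eq_all => -[]. Qed.

Lemma nonempty_columns_letters C :
  nonempty_columns (letters C) = all (fun s => s != [::]) C.
Proof.
rewrite /nonempty_columns all_map; apply: eq_all => s /=.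
by rewrite size_rev; case: s.
Qed.

Lemma sorted_falls s :
  sorted (falls x) s = sorted ltn (map fst s) && sorted (bumps x) (rev (map snd s)).
Proof. by rewrite rev_sorted !sorted_map -sorted_relI. Qed.

Local Notation stdr C := (column_reading (Std x (letters C))).

Lemma size_stdr C : size (stdr C) = size (flatten C).
Proof.
by rewrite column_reading_Std size_std_reading column_reading_letters size_map.
Qed.

(** Both comparisons come from [std_compatible] at positions [i] and [k], the second by
    distinctness; the pair lets one rewrite use either. *)
Lemma stdr_lt e (u0 : B *l nat) C i k : (i < k < size (flatten C))%N ->
  let u := stdr C in let F := flatten C in
  ((nth u0 u k < nth u0 u i)%O = bumps x (nth e F k).2 (nth e F i).2) *
  ((nth u0 u i < nth u0 u k)%O = ~~ bumps x (nth e F k).2 (nth e F i).2).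
Proof.
case/andP=> ik kF u F; have iF := ltn_trans ik kF.
have nthE j : (j < size F)%N -> (nth u0 u j).1 = (nth e F j).2.
  move=> jF; rewrite -(nth_map u0 e.2) ?size_stdr // -(nth_map e e.2) //.
  by rewrite /u column_reading_Std map_fst_std_reading column_reading_letters.
have := std_reading_pairwise x (column_reading (letters C)).
rewrite -column_reading_Std => /(pairwiseP u0)/(_ i k); rewrite !inE size_stdr.
move=> /(_ iF kF ik)/andP[/eqP ki neq]; rewrite -!nthE // -ki; split=> //.
by rewrite -leNgt lt_neqAle neq.
Qed.

(** The two hypotheses keep of the patterns just what contradicts [settled], so one argument covers
    all three pairs. *)
Lemma valid_no_occurrence C p q : valid x C ->
  (forall a b c : B *l nat, order_isomorphic [:: a; b; c] p ->
     (b < a)%O && (c < a)%O) ->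
  (forall a b c : nat, order_isomorphic [:: a; b; c] q -> (c < b)%N) ->
  ~ simultaneous_occurrence (stdr C)
      (column_reading (reverse_columns (times C))) p q.
Proof.
move=> vC hp hq [i [k []]]; rewrite column_reading_times size_stdr => /andP[ik kF].
have i1F := ltn_trans ik kF; have iF := ltnW i1F.
have [e _] : exists e, e \in flatten C.
  by case: (flatten C) kF => // e F _; exists e; apply: mem_head.
rewrite (letters_at3 ((e.2, 0) : B *l nat)) ?size_stdr // => /hp.
rewrite (letters_at3 e.1) ?size_map // => /andP[+ +] /hq.
rewrite !(nth_map e) // !(stdr_lt e) ?leqnn ?kF ?(ltnW ik) // => b1 b2.
have := valid_adjacent vC => /(adjacentP _ e)/(_ i k); rewrite ik kF /settled.
by rewrite b1 b2 leqNgt => /(_ isT)/= /negbTE->.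
Qed.

Lemma valid_stable C w : valid x C -> perm_eq (flatten C) (cells w) ->
  xps_stable_pairs x (letters C) (times C).
Proof.
move=> vC Cw; have /and3P[C0 sC CC] := vC.
have permQ : perm_eq (flatten (times C)) (iota 1 (size w)).
  rewrite flatten_times (perm_trans (perm_map fst Cw)) //.
  by rewrite -/(unzip1 _) unzip1_zip ?size_iota.
have xP : xps_tableau x (letters C).
  rewrite xps_tableauE nonempty_columns_letters C0 /=; apply/andP; split.
    rewrite all_map; apply: sub_all sC => s.
    by rewrite sorted_falls => /andP[].
  case: C C0 CC {vC Cw sC permQ} => // -[|e s] C // C0 CC.
  rewrite (bottom_row_letters e C0); apply: pairwise_sorted.
  rewrite pairwise_map; apply: sub_in_pairwise C0 CC => t t' /= t0 t'0.
  exact: precedes_last.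
have sQ : standard_ps (times C).
  apply/and4P; split.
  - by rewrite nonempty_columns_times.
  - by rewrite (perm_uniq permQ) iota_uniq.
  - rewrite all_map; apply: sub_all sC => s.
    by rewrite sorted_falls => /andP[].
  - case: C C0 CC sC {vC Cw xP permQ} => // -[|e s] C // C0 CC sC.
    rewrite (bottom_row_times e C0); apply: pairwise_sorted.
    rewrite pairwise_map; move/andP: (conj C0 sC); rewrite -all_predI => sC0.
    apply: sub_in_pairwise sC0 CC => t t' /= /andP[t0 st] /andP[t'0 _].
    (* By the [has] clause some [g] in [t] is older than the head of [t'], and the head of [t] is no
       later than [g]. *)
    case: t' t'0 => // f t' _ /= /andP[/andP[/hasP[g gt gf] _] _].
    rewrite ltEnat /=; apply: leq_ltn_trans gf; case: t t0 st gt => //= h t _ ht.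
    by rewrite inE => /predU1P[->//|/(allP (falls_all ht))/ltnW].
split=> //.
  rewrite /recording sQ; move/perm_size: (permQ); rewrite size_iota => sz.
  by rewrite /= sz.
split; split=> //.
- exact: standard_ps_Std.
- by rewrite shape_Std shape_letters shape_times.
- apply: valid_no_occurrence => // a b c;
    rewrite ?order_isomorphic312 ?order_isomorphic132.
    by case/and3P=> -> ->.
  by case/and3P.
- apply: valid_no_occurrence => // a b c;
    rewrite ?order_isomorphic312 ?order_isomorphic231.
    by case/and3P=> -> ->.
  by case/and3P.
- apply: valid_no_occurrence => // a b c;
    rewrite ?order_isomorphic321 ?order_isomorphic132.
    by case/and3P=> -> ->.
  by case/and3P.
Qed.

Lemma cells_of_shape (R : tableau B) (S : tableau nat) : shape R = shape S ->
  exists C, letters C = R /\ times C = S.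
Proof.
elim: R S => [|r R IH] [|s S] //=; first by exists [::].
case=> rs /IH[C [CR CS]]; exists (zip s (rev r) :: C).
rewrite /= CR CS -/(unzip1 _) -/(unzip2 _).
by rewrite unzip1_zip ?unzip2_zip ?size_rev ?rs // revK.
Qed.

Lemma cells_of_times (F : seq (nat * B)) :
  perm_eq (map fst F) (iota 1 (size F)) -> exists w, perm_eq F (cells w).
Proof.
(* The word is found by sorting the cells by time. *)
move=> Fi; pose G := sort (relpre fst leq) F; exists (map snd G).
have GF : unzip1 G = iota 1 (size F).
  rewrite /unzip1 /G -sort_map.
  apply: (sorted_eq leq_trans anti_leq); rewrite ?iota_sorted //.
    by apply: sort_sorted; apply: leq_total.
  by rewrite (permPl (permEl (perm_sort _ _))).
have -> : cells (map snd G) = G.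
  by rewrite /cells size_map size_sort -GF zip_unzip.
by rewrite perm_sym perm_sort.
Qed.

Lemma stable_valid (R : tableau B) (S : tableau nat) : xps_stable_pairs x R S ->
  exists C w, [/\ valid x C, perm_eq (flatten C) (cells w), letters C = R
    & times C = S].
Proof.
case=> xR /andP[sS permS] [[_ _ shRS] [no1 _ no3]].
have [C [CR CS]] : exists C, letters C = R /\ times C = S.
  by apply: cells_of_shape; rewrite -shRS shape_Std.
rewrite -{}CR -{}CS column_reading_times in xR sS permS no1 no3 {shRS} *.
rewrite flatten_times size_map in permS.
have [w Cw] := cells_of_times permS.
exists C, w; split=> //.
move: xR sS; rewrite xps_tableauE /standard_ps nonempty_columns_times.
rewrite flatten_times => /and3P[_ sR bR] /and4P[C0 uS sS bS].
case defC: C => [//|[|e s] C']; first by rewrite defC in C0.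
rewrite -defC {C' s defC}; apply: (@valid_of_weakly_settled _ _ _ e) => //.
- apply/allP=> s sC; rewrite sorted_falls; apply/andP; split.
    by move: sS; rewrite all_map => /allP/(_ s sC).
  by move: sR; rewrite all_map => /allP/(_ s sC).
- apply/(adjacentP _ e) => i k /andP[ik kF].
  have i1F := ltn_trans ik kF; have iF := ltnW i1F.
  apply/implyP=> /and3P[b1 b2 ltik]; rewrite leqNgt; apply/negP=> ltk1.
  pose u0 : B *l nat := (e.2, 0).
  have lt1 := stdr_lt e u0 (introT andP (conj (ltnSn i) i1F)).
  have lt2 := stdr_lt e u0 (introT andP (conj (ltnW ik) kF)).
  have lt3 := stdr_lt e u0 (introT andP (conj ik kF)).
  (* The comparison of the last two letters decides between 321 and 312; the time pattern is 132 in
     both cases. *)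
  case b3: (bumps x (nth e (flatten C) k).2 (nth e (flatten C) i.+1).2).
    apply: no3; exists i, k; split; first by rewrite size_stdr ik.
      rewrite (letters_at3 u0) ?size_stdr // order_isomorphic321.
      by rewrite lt1 lt2 lt3 b1 b2 b3.
    rewrite (letters_at3 e.1) ?size_map // !(nth_map e) // order_isomorphic132.
    by rewrite !ltEnat /= ltik ltk1 (ltn_trans ltik).
  apply: no1; exists i, k; split; first by rewrite size_stdr ik.
    rewrite (letters_at3 u0) ?size_stdr // order_isomorphic312.
    by rewrite lt1 lt2 lt3 b1 b2 b3.
  rewrite (letters_at3 e.1) ?size_map // !(nth_map e) // order_isomorphic132.
  by rewrite !ltEnat /= ltik ltk1 (ltn_trans ltik).
(* Transitivity turns the two sorted bottom rows into pairwise conditions, which combine into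
   [bottoms_ordered]. *)
- move: bR bS; rewrite (bottom_row_letters e C0) (bottom_row_times e C0).
  rewrite !sorted_pairwise.
  + rewrite !pairwise_map => bR bS; move/andP: (conj bS bR).
    by rewrite -pairwise_relI.
  + by move=> a b c; apply: lt_trans.
  + by move=> b a c; apply: Nbumps_trans.
Qed.

End StablePairs.

Theorem theorem3p3 (d : Order.disp_t) (B : orderType d) (x : side) :
  [/\ forall w : seq B, xps_stable_pairs x (P_ps x w) (Q_ps x w),
      injective (fun w : seq B => (P_ps x w, Q_ps x w))
    & forall (R : tableau B) (S : tableau nat), xps_stable_pairs x R S ->
        exists w : seq B, (P_ps x w, Q_ps x w) = (R, S)].
Proof.
split=> [w|w w'|R S].
- rewrite /P_ps /Q_ps; have [C [vC Cw ->]] := ps_insertion_valid x w.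
  exact: valid_stable vC Cw.
- by rewrite /P_ps /Q_ps -!surjective_pairing => /ps_insertion_inj.
- case/stable_valid=> C [w [vC Cw <- <-]]; exists w.
  by rewrite /P_ps /Q_ps (ps_insertion_of_valid vC Cw).
Qed.
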